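(* Let $r\ge 3$ and $\Delta\ge 2$ be integers. Consider (not necessarily linear) finite hypergraphs with maximum rank $r$ and maximum degree $\Delta$. (i) There exists a uniform such hypergraph $H$ with $q(H)=r(\Delta-1)+1$ if and only if an $(r(\Delta-1)+1,\Delta,1)$ BIBD exists. (ii) If a projective plane of order $r-2$ exists and $r-1$ divides $\Delta$, then there exists a uniform such hypergraph $H$ with $q(H)=\Delta(r^2-3r+3)/(r-1)$. (iii) If a projective design with $n=r(r-1)$ vertices, all edges of rank $r$ and all vertex degrees equal to $\Delta$ exists, then there exists a uniform such hypergraph $H$ with $q(H)=\Delta(r-1)$.
   Context: A hypergraph $H=(V,E)$ is a finite set $V$ with a set $E$ of subsets of $V$ (edges). The rank of an edge is its cardinality; the degree of a vertex is the number of edges containing it. $H$ is uniform if all edges have the same rank, regular if all vertices have the same degree, and linear if any two distinct edges share at most one vertex. An edge coloring of $H$ is a map $\gamma:E\to\Gamma$ such that $\gamma(e)=\gamma(f)$ for distinct edges $e,f$ only if $e\cap f=\emptyset$; the chromatic index $q(H)$ is the minimum $|\Gamma|$ over all edge colorings. A $(v,k,1)$ BIBD is a linear hypergraph with $v$ vertices, all edges of rank $k$, in which every pair of distinct vertices lies in exactly one edge. A projective design is a uniform regular hypergraph in which every two edges have nonempty intersection. A projective plane of order $m$ is an $(m^2+m+1,m+1,1)$ BIBD. *)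

(* Defs.v *)
From HB Require Import structures.
From mathcomp Require Import all_boot.

Set Implicit Arguments.
Unset Strict Implicit.
Unset Printing Implicit Defensive.

Record hypergraph := Hypergraph {
  vertex :> finType;
  edges : {set {set vertex}} }.

Section Hypergraph.
Variable H : hypergraph.

(* The rank of an edge [e] is [#|e|]. *)
Definition degree (x : H) : nat := #|[set e in edges H | x \in e]|.

Definition max_rank : nat := \max_(e in edges H) #|e|.
Definition max_degree : nat := \max_(x : H) degree x.

Definition uniform : Prop := {in edges H &, forall e f : {set H}, #|e| = #|f|}.
Definition regular : Prop := forall x y : H, degree x = degree y.
Definition linear : Prop :=
  {in edges H &, forall e f : {set H}, e != f -> #|e :&: f| <= 1}.

Definition edge : finType := {e : {set H} | e \in edges H}.

Definition edge_coloring (Gamma : finType) (gamma : {ffun edge -> Gamma}) : bool :=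
  [forall e : edge, forall f : edge,
     (e != f) && (gamma e == gamma f) ==> (val e :&: val f == set0)].

Definition edge_colorable (k : nat) : bool :=
  [exists gamma : {ffun edge -> 'I_k}, edge_coloring gamma].

Lemma ex_edge_colorable : exists k, edge_colorable k.
Proof.
exists #|edge|; apply/existsP; exists [ffun e => enum_rank e].
apply/forallP=> e; apply/forallP=> f; apply/implyP; rewrite !ffunE.
by case/andP=> /negP nef /eqP/enum_rank_inj/eqP.
Qed.

Definition chromatic_index : nat := ex_minn ex_edge_colorable.

(* Color sets of the form ['I_k] are no restriction. *)
Lemma chromatic_index_le (Gamma : finType) (gamma : {ffun edge -> Gamma}) :
  edge_coloring gamma -> chromatic_index <= #|Gamma|.
Proof.
move=> colg; rewrite /chromatic_index; case: ex_minnP => k _; apply.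
apply/existsP; exists [ffun e => enum_rank (gamma e)].
apply/forallP=> e; apply/forallP=> f; apply/implyP; rewrite !ffunE.
case/andP=> nef /eqP/enum_rank_inj/eqP gef.
by move/forallP/(_ e)/forallP/(_ f)/implyP: colg; apply; rewrite nef.
Qed.

Lemma chromatic_index_attained :
  exists gamma : {ffun edge -> 'I_chromatic_index}, edge_coloring gamma.
Proof.
by rewrite /chromatic_index; case: ex_minnP => k /existsP.
Qed.

Definition BIBD (v k : nat) : Prop :=
  [/\ linear, #|H| = v, {in edges H, forall e : {set H}, #|e| = k}
    & forall x y : H, x != y ->
        #|[set e in edges H | (x \in e) && (y \in e)]| = 1].

Definition projective_plane (m : nat) : Prop := BIBD (m ^ 2 + m + 1) (m + 1).

Definition projective_design : Prop :=
  [/\ uniform, regular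
    & {in edges H &, forall e f : {set H}, e != f -> e :&: f != set0}].

End Hypergraph.

(* Main.v *)
Require Import Defs.
From mathcomp Require Import all_boot zify.

Set Implicit Arguments.
Unset Strict Implicit.
Unset Printing Implicit Defensive.

(** In a hypergraph of rank at most [r] and degree at most [Delta], an edge meets
    at most [r * (Delta - 1)] others, so by Brooks' theorem the line graph needs
    [r * (Delta - 1) + 1] colors only if it contains a clique of that size.  In
    such a clique the count of incidences is tight: every vertex it covers lies
    on [Delta] of its edges and two of its edges share exactly one vertex, so the
    dual of the clique is the required BIBD.  Conversely, and in (ii) and (iii),
    the extremal hypergraphs have pairwise intersecting edges, so that the
    chromatic index is the number of edges: take the dual of the BIBD in (i); in
    (ii) take each line of the plane [Delta / (r - 1)] times, each copy with a
    private vertex added; in (iii) take the design itself.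

    Brooks' theorem is proved by coloring along a maximal path, in the style of
    Zajac. *)

(** * Brooks' theorem for graphs of maximum degree at most [k] *)

Section Brooks.
Variables (T : finType) (adj : rel T) (k : nat).
Hypothesis adj_sym : symmetric adj.
Hypothesis adj_irr : irreflexive adj.
Hypothesis deg_le : forall x, #|[set y | adj x y]| <= k.

Definition proper_on (c : T -> 'I_k) (A : {set T}) : Prop :=
  {in A &, forall x y, adj x y -> c x != c y}.

Lemma proper_extend c (A : {set T}) x (i : 'I_k) :
  proper_on c A -> x \notin A -> {in A, forall y, adj x y -> c y != i} ->
  exists c', [/\ {in A, c' =1 c}, c' x = i & proper_on c' (x |: A)].
Proof.
move=> cA xA ci; pose c' y := if y == x then i else c y.
have c'A : {in A, c' =1 c}.
  by move=> y yA; rewrite /c'; case: eqP => // yx; rewrite -yx yA in xA.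
have c'x : c' x = i by rewrite /c' eqxx.
exists c'; split=> // y z /setU1P[->|yA] /setU1P[->|zA].
- by rewrite adj_irr.
- by move=> xz; rewrite c'x c'A // eq_sym; apply: ci.
- by move=> yx; rewrite c'x c'A //; apply: ci; rewrite // adj_sym.
- by rewrite !c'A //; apply: cA.
Qed.

Lemma extend_few_colors c (A : {set T}) x :
  proper_on c A -> x \notin A -> #|c @: [set y in A | adj x y]| < k ->
  exists2 c', {in A, c' =1 c} & proper_on c' (x |: A).
Proof.
move=> cA xA; rewrite -[X in _ < X]card_ord => ltk.
have /existsP[i iN] : [exists i, i \notin c @: [set y in A | adj x y]].
  rewrite -negb_forall; apply: contraL ltk => /forallP all_i.
  by rewrite -leqNgt; apply/subset_leq_card/subsetP.
have [y yA xy|c' [? _ ?]] := @proper_extend c A x i cA xA; last by exists c'.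
by apply: contraNneq iN => <-; apply: imset_f; rewrite inE yA.
Qed.

(** The uncolored [y] is one of at most [k] neighbors of [x], so fewer than [k] colors are
    forbidden. *)
Lemma extend_uncolored c (A : {set T}) x y :
  proper_on c A -> x \notin A -> adj x y -> y \notin A ->
  exists2 c', {in A, c' =1 c} & proper_on c' (x |: A).
Proof.
move=> cA xA xy yA; apply: extend_few_colors => //.
apply: leq_ltn_trans (leq_imset_card _ _) (leq_trans _ (deg_le x)).
apply/proper_card/properP; split; first by apply/subsetP=> z; rewrite !inE => /andP[].
by exists y; rewrite !inE // (negPf yA).
Qed.

(** Dropping [y] from the neighborhood of [x] loses no color, so at most [k - 1] are forbidden. *)
Lemma extend_repeated c (A : {set T}) x y z :
  proper_on c A -> x \notin A -> y \in A -> z \in A -> adj x y -> adj x z ->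
  y != z -> c y = c z ->
  exists2 c', {in A, c' =1 c} & proper_on c' (x |: A).
Proof.
move=> cA xA yA zA xy xz yz cyz; apply: extend_few_colors => //.
apply: (@leq_ltn_trans #|c @: ([set u in A | adj x u] :\ y)|).
  apply/subset_leq_card/subsetP=> _ /imsetP[u uN ->].
  have [->|uy] := eqVneq u y; last by apply: imset_f; rewrite in_setD1 uy.
  by rewrite cyz; apply: imset_f; rewrite !inE eq_sym yz zA.
apply: leq_ltn_trans (leq_imset_card _ _) (leq_trans _ (deg_le x)).
apply/proper_card/properP; split; last by exists y; rewrite !inE ?eqxx.
by apply/subsetP=> u; rewrite !inE => /and3P[].
Qed.

(** Greedy coloring along the path: each vertex is colored while its successor is still uncolored.
    The end [y] is left uncolored for the sake of the last vertex of [s]. *)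
Lemma extend_path s y c (A : {set T}) :
  proper_on c A -> sorted adj (rcons s y) -> uniq (rcons s y) ->
  {in rcons s y, forall x, x \notin A} ->
  exists2 c', {in A, c' =1 c} & proper_on c' (A :|: [set x in s]).
Proof.
elim: s c A => [|a s IHs] c A cA.
  by exists c => // x z; rewrite !inE !orbF; apply: cA.
move=> /= as_y /andP[ays us] sA.
have aA : a \notin A by apply: sA; rewrite mem_head.
have sA' : {in rcons s y, forall x, x \notin A}.
  by move=> x xs; apply: sA; rewrite inE xs orbT.
have [c1 c1A c1p] : exists2 c', {in A, c' =1 c} & proper_on c' (a |: A).
  case: s as_y sA' {IHs us sA ays} => [|b s] /= /andP[ab _] sA';
    by apply: (extend_uncolored cA aA ab); apply: sA'; rewrite mem_head.
have [x xs|c2 c2A c2p] := IHs c1 _ c1p (path_sorted as_y) us.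
  by rewrite !inE negb_or sA' // andbT; apply: contraNneq ays => <-.
exists c2; first by move=> x xA; rewrite c2A ?c1A // inE xA orbT.
have -> // : A :|: [set x in a :: s] = a |: A :|: [set x in s].
by apply/setP=> x; rewrite !inE orbA (orbC (x == a)).
Qed.

(** Extend at the end as long as possible. The start is prescribed because the path used later must
    begin with [v1 v2 v3]. *)
Lemma maximal_path (S : {set T}) x p :
  path adj x p -> uniq (x :: p) -> {subset x :: p <= S} ->
  exists q, [/\ path adj x (p ++ q), uniq (x :: p ++ q),
    {subset x :: p ++ q <= S} &
    {in S, forall y, adj (last x (p ++ q)) y -> y \in x :: p ++ q}].
Proof.
have [n] := ubnP (#|T| - size p); elim: n p => // n IHn p ltn xp up pS.
have [/existsP[y /and3P[yS ly yp]]|] :=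
    boolP [exists y, [&& y \in S, adj (last x p) y & y \notin x :: p]].
  have up' : uniq (x :: rcons p y) by rewrite -rcons_cons rcons_uniq yp.
  have : size (x :: rcons p y) <= #|T| by rewrite -(card_uniqP up') max_card.
  rewrite /= size_rcons => lep.
  have [||||q []] := IHn (rcons p y) => //.
  - by rewrite size_rcons subnS -ltnS prednK ?subn_gt0 ?(ltnW lep).
  - by rewrite rcons_path xp.
  - by move=> z; rewrite -rcons_cons mem_rcons inE => /predU1P[->//|/pS].
  by rewrite cat_rcons; exists (y :: q).
rewrite negb_exists => /forallP maxp; exists [::]; rewrite cats0; split=> // y yS ly.
by apply: contraNT (maxp y) => yp; apply/and3P.
Qed.

Lemma path_exit (P : pred T) x p :
  P x -> ~~ P (last x p) ->
  exists p1 y z p2, [/\ x :: p = p1 ++ y :: z :: p2, P y & ~~ P z].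
Proof.
elim: p x => [|z p IHp] x Px /=; first by rewrite Px.
have [Pz lp|Pz _] := boolP (P z); last by exists [::], x, z, p.
by have [p1 [y [u [p2 [-> Py Pu]]]]] := IHp z Pz lp; exists (x :: p1), y, u, p2.
Qed.

(* Some edge [v w] of the cycle goes from a vertex with an outside neighbor [x] to
   one without.  Give [w] the color of [x], then go around from [w] to [v]: each
   vertex before [v] still has an uncolored neighbor, and [v] has two neighbors
   of the same color. *)
Lemma cycle_extend (S : {set T}) s c u y :
  cycle adj s -> uniq s ->
  {in S, forall z, adj (last u s) z -> z \in s} ->
  u \in s -> y \in S -> y \notin s -> adj u y ->
  proper_on c (S :\: [set x in s]) -> exists c', proper_on c' S.
Proof.
move=> cs us lastN us_ yS ys uy cA.
pose P x := [exists z, [&& z \in S, z \notin s & adj x z]].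
have Pu : P u by apply/existsP; exists y; apply/and3P.
(* [P] holds at [u] and fails at the last vertex, whose neighbors in [S] all lie on the cycle, so it
   switches between two consecutive vertices. *)
have [s1 [v [w [s2 [Es Pv Pw]]]]] :
    exists s1 v w s2, [/\ s = s1 ++ v :: w :: s2, P v & ~~ P w].
  have [p1 [p2 Es]] : exists p1 p2, s = p1 ++ u :: p2.
    by case/splitPr: us_ => p1 p2; exists p1, p2.
  have [|p3 [v [w [p4 [Ep Pv Pw]]]]] := @path_exit P u p2 Pu.
    apply/existsP=> -[z /and3P[zS zs lz]]; move: (lastN z zS).
    by rewrite Es last_cat /= lz -Es (negPf zs) => /(_ isT).
  by exists (p1 ++ p3), v, w, p4; rewrite Es Ep -catA.
have {Pw} Nw z : z \in S -> adj w z -> z \in s.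
  move=> zS wz; apply: contraNT Pw => zs; apply/existsP; exists z.
  by rewrite zS zs wz.
have [x /and3P[xS xs vx]] := existsP Pv.
(* Rotated to start at [w], the cycle ends at [v], and [s2 ++ s1] is the path strictly between
   them. *)
have Ers : rot (size s1).+1 s = w :: s2 ++ rcons s1 v.
  by rewrite Es -cat_rcons -(size_rcons s1 v) rot_size_cat.
have us' : uniq (w :: rcons (s2 ++ s1) v) by rewrite rcons_cat -Ers rot_uniq.
have cs' : cycle adj (w :: rcons (s2 ++ s1) v) by rewrite rcons_cat -Ers rot_cycle.
have ms' : w :: rcons (s2 ++ s1) v =i s by move=> z; rewrite rcons_cat -Ers mem_rot.
have wA : w \notin S :\: [set x in s] by rewrite !inE -ms' mem_head.
have [|c1 [c1A c1w c1p]] := @proper_extend c _ w (c x) cA wA.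
  by move=> z; rewrite !inE => /andP[/negP zs zS] wz; case: zs; apply: Nw.
move: cs'; rewrite /= rcons_path last_rcons => /andP[pw vw].
move: us'; rewrite cons_uniq => /andP[ws us'].
have [z zs|c2 c2A c2p] := extend_path c1p (path_sorted pw) us'.
  rewrite !inE negb_or -ms' [z \in _ :: _]inE zs orbT andbT.
  by apply: contraNneq ws => <-.
have [|||||||c3 _ c3p] := @extend_repeated c2 _ v x w c2p => //.
- rewrite rcons_uniq in us'; case/andP: us' => vs _.
  rewrite !inE -ms' [v \in _ :: _]inE mem_rcons mem_head (negPf vs) orbT orbF.
  by rewrite orbF; apply: contraNneq ws => <-; rewrite mem_rcons mem_head.
- by rewrite !inE xS xs !orbT.
- by rewrite !inE eqxx.
- by apply: contraNneq xs => ->; rewrite -ms' mem_head.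
- rewrite !c2A ?c1w ?c1A //; first by rewrite !inE xS xs.
    by rewrite !inE eqxx.
  by rewrite !inE xS xs orbT.
exists c3 => a b aS bS; apply: c3p.
all: rewrite !inE ?aS ?bS andbT -ms' [_ \in _ :: _]inE mem_rcons inE.
  by case: (a == v); case: (a == w); case: (a \in _).
by case: (b == v); case: (b == w); case: (b \in _).
Qed.

(* Give [v1] and [v3] the same color, color [q] up to [w] forwards and then from
   its end back to [w], so that each vertex still has an uncolored neighbor;
   finally [v2] has two neighbors of the same color. *)
Lemma closed_path_extend (S : {set T}) v1 v2 v3 q w c :
  path adj v1 [:: v2, v3 & q] -> uniq [:: v1, v2, v3 & q] -> 0 < k ->
  ~~ adj v1 v3 -> w \in q -> adj v2 w ->
  {in [:: v1, v2, v3 & q] & S, forall x y, adj x y -> y \in [:: v1, v2, v3 & q]} ->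
  proper_on c (S :\: [set x in [:: v1, v2, v3 & q]]) -> exists c', proper_on c' S.
Proof.
move=> /and3P[v12 v23 pq] uq k_gt0 v13 wq v2w closed cA.
pose A := S :\: [set x in [:: v1, v2, v3 & q]].
have notA x : x \in [:: v1, v2, v3 & q] -> x \notin A by rewrite !inE => ->.
have NA x y : x \in [:: v1, v2, v3 & q] -> y \in A -> adj x y = false.
  move=> xs /setDP[yS]; rewrite inE => ys; apply: contraNF ys.
  exact: closed.

have v1A : v1 \notin A by apply: notA; rewrite mem_head.
(* The path has no neighbors in [A], and [v1], [v3] are not adjacent, so color 0 is free for
   both. *)
have v1N : {in A, forall y, adj v1 y -> c y != Ordinal k_gt0}.
  by move=> y yA; rewrite NA // mem_head.
have [c1 [c1A c1v1 c1p]] := proper_extend cA v1A v1N.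
move: (uq); rewrite /= !inE !negb_or.
case/and4P=> /and3P[v1v2 v1v3 v1q] /andP[v2v3 v2q] v3q uqq.
have v3A : v3 \notin v1 |: A.
  by rewrite in_setU1 negb_or eq_sym v1v3 notA // !inE eqxx !orbT.
have v3N : {in v1 |: A, forall y, adj v3 y -> c1 y != Ordinal k_gt0}.
  move=> y /setU1P[->|yA]; first by rewrite adj_sym (negPf v13).
  by rewrite NA // !inE eqxx !orbT.
have [c2 [c2A c2v3 c2p]] := proper_extend c1p v3A v3N.
have qA x : x \in q -> x \notin v3 |: (v1 |: A).
  move=> xq; rewrite !in_setU1 !negb_or notA ?inE ?xq ?orbT // andbT.
  by apply/andP; split; [apply: contraNneq v3q|apply: contraNneq v1q] => <-.
have [q1 [q2 Eq]] : exists q1 q2, q = q1 ++ w :: q2.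
  by case/splitPr: wq => q1 q2; exists q1, q2.
have [sq1 sq2] : sorted adj (rcons q1 w) /\ path adj w q2.
  by apply/andP; rewrite -sorted_cat_cons -Eq; apply: path_sorted pq.
have q2q : {subset w :: q2 <= q} by move=> x xq2; rewrite Eq mem_cat xq2 orbT.
have q1q : {subset rcons q1 w <= q}.
  by move=> x xq1; rewrite Eq -cat_rcons mem_cat xq1.
have uq1 : uniq (rcons q1 w).
  by move: uqq; rewrite Eq -cat_rcons cat_uniq => /andP[].
have [q12 uq2] : ~~ has (mem q1) (w :: q2) /\ uniq (w :: q2).
  by apply/andP; move: uqq; rewrite Eq cat_uniq => /andP[].
have [x /q1q/qA//|c3 c3A c3p] := extend_path c2p sq1 uq1.
have v2A3 : v2 \notin v3 |: (v1 |: A) :|: [set x in q1].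
  have v2A : v2 \notin A by apply: notA; rewrite !inE eqxx orbT.
  rewrite in_setU !in_setU1 inE !negb_or v2v3 (negPf v2A) eq_sym v1v2 /=.
  by apply: contra v2q => v2q1; apply: q1q; rewrite mem_rcons inE v2q1 orbT.
(* The second half is run backwards with [v2] as its uncolored end, so that [w] too has an uncolored
   neighbor when its turn comes. *)
have Erev : rcons (rev (w :: q2)) v2 = rev [:: v2, w & q2] by rewrite [RHS]rev_cons.
have [||x|c4 c4A c4p] := @extend_path (rev (w :: q2)) v2 c3 _ c3p.
- rewrite Erev rev_sorted /= adj_sym v2w /=.
  by rewrite (eq_path (e' := adj)) // => a b; rewrite adj_sym.
- by rewrite Erev rev_uniq cons_uniq uq2 andbT; apply: contra v2q; apply: q2q.
- rewrite mem_rcons inE mem_rev => /predU1P[->//|xq2].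
  rewrite in_setU negb_or qA ?q2q // inE.
  by apply: contra q12 => xq1; apply/hasP; exists x.
have v1A4 : v1 \in v1 |: A by rewrite setU11.
have v3A4 : v3 \in v3 |: (v1 |: A) by rewrite setU11.
have v1A4' : v1 \in v3 |: (v1 |: A) by rewrite in_setU1 v1A4 orbT.
have [|||||||c5 _ c5p] := @extend_repeated c4 _ v2 v1 v3 c4p => //.
- rewrite in_setU negb_or v2A3 inE mem_rev.
  by apply: contra v2q; apply: q2q.
- by rewrite in_setU in_setU v1A4'.
- by rewrite in_setU in_setU v3A4.
- by rewrite adj_sym.
- by rewrite !c4A ?c3A ?c2v3 ?c2A ?c1v1 // in_setU ?v1A4' ?v3A4.
exists c5; suff sub : S \subset
    v2 |: (v3 |: (v1 |: A) :|: [set x in q1] :|: [set x in rev (w :: q2)]).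
  by move=> x y /(subsetP sub) xS /(subsetP sub) yS; apply: c5p.
apply/subsetP=> x xS; rewrite !inE mem_rev inE xS andbT Eq mem_cat inE.
by do 6?case: (_ == _) => //=; do 2?case: (x \in _).
Qed.

(* The last vertex [l] of a maximal path starting with [v1 v2 v3] has all its
   neighbors on the path; the first of them closes a cycle, which either has an
   outside neighbor or is the whole path. *)
Lemma critical_colorable (S : {set T}) :
  2 < k ->
  (forall K : {set T}, #|K| = k.+1 ->
     exists x y, [/\ x \in K, y \in K, x != y & ~~ adj x y]) ->
  (forall A : {set T}, A \proper S -> exists c, proper_on c A) ->
  exists c, proper_on c S.
Proof.
move=> k_gt2 nclique crit; have k_gt0 : 0 < k by apply: leq_trans k_gt2.
have [/exists_inP[x xS ltk]|] :=
    boolP [exists x in S, #|[set y in S | adj x y]| < k].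
  have [c cp] := crit _ (properD1 xS).
  have xSx : x \notin S :\ x by rewrite !inE eqxx.
  have [|c' _] := extend_few_colors cp xSx.
    apply: leq_ltn_trans (leq_imset_card _ _) (leq_ltn_trans _ ltk).
    by apply/subset_leq_card/subsetP=> y; rewrite !inE => /andP[/andP[_ ->]].
  by rewrite setD1K //; exists c'.
rewrite negb_exists_in => /forall_inP degS.
have {}degS x : x \in S -> k <= #|[set y in S | adj x y]|.
  by move/degS; rewrite -leqNgt.
have [->|[v2 v2S]] := set_0Vmem S.
  by exists (fun=> Ordinal k_gt0) => x y; rewrite inE.
(* [v2] has exactly [k] neighbors in [S], so its closed neighborhood has [k + 1] vertices and is no
   clique; a non-adjacent pair in it avoids [v2]. *)
have [|v1 [v3 [v1K v3K v13 nadj]]] :=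
    nclique (v2 |: [set y in S | adj v2 y]).
  rewrite cardsU1 !inE adj_irr andbF add1n; congr _.+1; apply/eqP.
  rewrite eqn_leq degS // andbT; apply: leq_trans (deg_le v2).
  by apply/subset_leq_card/subsetP=> y; rewrite !inE => /andP[].
have {v1K} [v1S v21] : v1 \in S /\ adj v2 v1.
  move: v1K; rewrite !inE => /predU1P[E|/andP[]//]; move: v3K nadj v13.
  by rewrite E !inE eq_sym => /predU1P[->|/andP[_ ->]//]; rewrite eqxx.
have {v3K} [v3S v23] : v3 \in S /\ adj v2 v3.
  move: v3K; rewrite !inE => /predU1P[E|/andP[]//].
  by rewrite E adj_sym v21 in nadj.
have [||x|q [pq uq qS maxq]] := @maximal_path S v1 [:: v2; v3].
- by rewrite /= adj_sym v21 v23.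
- rewrite /= !inE negb_or v13 !andbT; apply/andP; split.
    by apply: contraTneq v21 => ->; rewrite adj_irr.
  by apply: contraTneq v23 => ->; rewrite adj_irr.
- by rewrite !inE => /or3P[] /eqP->.
set p := [:: v1, v2, v3 & q]; set l := last v1 _ in maxq.
have Ep : p = v1 :: [:: v2; v3] ++ q by [].
have lp : l \in p by apply: mem_last.
have hasl : has (adj l) p.
  have /card_gt0P[y] : 0 < #|[set y in S | adj l y]|.
    by apply: leq_trans (degS _ (qS _ lp)).
  by rewrite inE => /andP[yS ly]; apply/hasP; exists y; rewrite ?maxq.
(* [w] is the first neighbor of [l] on the path, so the cycle [w :: p2] contains all neighbors of
   [l] in [S]. *)
have [p1 [w [p2 [Ep12 lw p1N]]]] :
    exists p1 w p2, [/\ p = p1 ++ w :: p2, adj l w & ~~ has (adj l) p1].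
  case: (split_find hasl) => w p1 p2 lw p1N; exists p1, w, p2.
  by rewrite cat_rcons.
have up : uniq p by [].
have sC : {subset w :: p2 <= p}.
  by move=> x xC; rewrite Ep12 mem_cat xC orbT.
have pC : {subset p <= S} by [].
have lC x : x \in S -> adj l x -> x \in w :: p2.
  move=> xS lx; move: (maxq x xS lx); rewrite -Ep Ep12 mem_cat.
  by case/orP=> // xp1; case/hasP: p1N; exists x.
have sp : sorted adj (p1 ++ w :: p2) by rewrite -Ep12.
have El : last w p2 = l.
  by rewrite /l -[last v1 _]/(last v1 p) Ep12 last_cat.
have [|c cp] := crit (S :\: [set x in w :: p2]).
  apply/properP; split; first exact: subsetDl.
  by exists w; [apply/pC/sC|]; rewrite ?inE eqxx.
have [/exists_inP[u uC /exists_inP[y yS /andP[yC uy]]]|] :=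
    boolP [exists u in w :: p2, exists y in S, (y \notin w :: p2) && adj u y].
  apply: (@cycle_extend S (w :: p2) c u y) => //.
  - rewrite /cycle rcons_path El lw andbT.
    by move: sp; rewrite sorted_cat_cons => /andP[].
  - by move: up; rewrite Ep12 cat_uniq => /and3P[].
  - by move=> z zS; rewrite -/(last w p2) /= El; apply: lC.
rewrite negb_exists_in => /forall_inP closed.
have {}closed : {in w :: p2 & S, forall x y, adj x y -> y \in w :: p2}.
  move=> x y xC yS xy; move: (closed x xC); rewrite negb_exists_in.
  by move/forall_inP/(_ y yS); rewrite xy andbT negbK.
(* Otherwise the predecessor of [w] on the path would be a neighbor outside the cycle. *)
have p1nil : p1 = [::].
  case/lastP: p1 Ep12 {p1N} sp => // p1 z Ep12; rewrite cat_rcons sorted_cat_cons.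
  case/and3P=> _ zw _; have zS : z \in S.
    by apply: pC; rewrite Ep12 mem_cat mem_rcons mem_head.
  have := closed w z (mem_head _ _) zS; rewrite adj_sym => /(_ zw) zC.
  move: up; rewrite Ep12 cat_uniq => /and3P[_ /hasPn/(_ z zC)].
  by rewrite mem_rcons mem_head.
have EC : w :: p2 = p by rewrite Ep12 p1nil.
rewrite EC in closed cp.
(* [v2] has at least three neighbors in [S]; one other than [v1] and [v3] lies further along the
   path. *)
have [z zq v2z] : exists2 z, z \in q & adj v2 z.
  have /subsetPn[z] : ~~ ([set y in S | adj v2 y] \subset [set v1; v3]).
    apply/negP=> /subset_leq_card; rewrite cards2 leqNgt => /negP[].
    by apply: leq_ltn_trans (leq_trans k_gt2 (degS _ v2S)); case: (_ != _).
  rewrite !inE negb_or => /andP[zS v2z] /andP[z1 z3]; exists z => //.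
  have := closed v2 z _ zS v2z; rewrite !inE eqxx orbT (negPf z1) (negPf z3) /=.
  by move/(_ isT)/predU1P=> [zv2|//]; rewrite zv2 adj_irr in v2z.
exact: (@closed_path_extend S v1 v2 v3 q z c).
Qed.

(** Induction on the size of the colored set. Odd cycles, the exception besides cliques, are
    excluded by [2 < k]. *)
Theorem brooks :
  2 < k ->
  (forall K : {set T}, #|K| = k.+1 ->
     exists x y, [/\ x \in K, y \in K, x != y & ~~ adj x y]) ->
  exists c : T -> 'I_k, forall x y, adj x y -> c x != c y.
Proof.
move=> k_gt2 nclique.
suff all_col (S : {set T}) : exists c, proper_on c S.
  by have [c cp] := all_col setT; exists c => x y; apply: cp; rewrite inE.
have [n] := ubnP #|S|; elim: n S => // n IHn S ltSn.
apply: critical_colorable => // A /proper_card ltA.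
by apply: IHn; apply: leq_trans ltA _.
Qed.
End Brooks.

(** * Double counting of incidences *)

Lemma sum_card_incidence (T : finType) (M : {set {set T}}) (f : {set T}) :
  \sum_(g in M) #|f :&: g| = \sum_(x in f) #|[set g in M | x \in g]|.
Proof.
under eq_bigr do rewrite -sum1_card.
under [RHS]eq_bigr do rewrite -sum1_card.
rewrite (exchange_big_dep (fun x => x \in f)) => [|g x _ /setIP[]//].
by apply: eq_bigr => x xf; apply: eq_bigl => g; rewrite !inE xf.
Qed.

(** This is how tight incidence counts are exploited, in planes and in cliques. *)
Lemma eq_sum_leq (I : finType) (A : {set I}) (E1 E2 : I -> nat) :
  {in A, forall i, E1 i <= E2 i} -> \sum_(i in A) E2 i <= \sum_(i in A) E1 i ->
  {in A, E1 =1 E2}.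
Proof.
move=> leE geS i iA.
have leif j : j \in A -> E1 j <= E2 j ?= iff (E1 j == E2 j).
  by move=> jA; split; first exact: leE.
have [leS] := leqif_sum leif; rewrite eqn_leq leS geS => /esym/forall_inP/(_ i iA).
by move/eqP.
Qed.

(** Edges form a set, so coinciding images would be counted once; injectivity lets the degree be
    counted on indices. *)
Lemma degree_imset (T I : finType) (E : I -> {set T}) (A : {set I}) (x : T) :
  {in A &, injective E} ->
  @degree (Hypergraph (E @: A)) x = #|[set i in A | x \in E i]|.
Proof.
move=> injE; rewrite /degree /= -(card_in_imset (f := E)); last first.
  by move=> i j; rewrite !inE => /andP[iA _] /andP[jA _]; apply: injE.
congr #|pred_of_set _|; apply/setP=> e; rewrite inE; apply/andP/imsetP.
  by case=> /imsetP[i iA ->] xE; exists i; rewrite ?inE ?iA.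
by case=> i; rewrite inE => /andP[iA xE] ->; split; first exact: imset_f.
Qed.

(** * Intersecting hypergraphs and block designs *)

Section Hypergraphs.
Variable H : hypergraph.

Lemma max_rank_uniform r (e0 : {set H}) :
  e0 \in edges H -> {in edges H, forall e : {set H}, #|e| = r} -> max_rank H = r.
Proof.
move=> e0E rankE; apply/eqP; rewrite eqn_leq; apply/andP; split.
  by apply/bigmax_leqP=> e /rankE->.
by rewrite -(rankE _ e0E); apply: (bigmax_sup e0).
Qed.

Lemma max_degree_attained d (x0 : H) :
  degree x0 = d -> (forall x : H, degree x <= d) -> max_degree H = d.
Proof.
move=> <- le_d; apply/eqP; rewrite eqn_leq; apply/andP; split.
  by apply/bigmax_leqP.
exact: (bigmax_sup x0).
Qed.

(** Edges of the same color are disjoint, so here every edge coloring is injective, while the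
    identity is always one. *)
Lemma intersecting_chromatic_index :
  {in edges H &, forall e f : {set H}, e != f -> e :&: f != set0} ->
  chromatic_index H = #|edges H|.
Proof.
move=> intersect.
have <- : #|edge H| = #|edges H| by rewrite card_sig; apply: eq_card.
apply/eqP; rewrite eqn_leq; apply/andP; split.
  apply: (@chromatic_index_le _ _ [ffun e => e]).
  apply/forallP=> e; apply/forallP=> f; rewrite !ffunE.
  by case: eqP.
have [gamma /forallP colg] := chromatic_index_attained H.
rewrite -[X in _ <= X]card_ord; apply: (leq_card gamma) => e f gef.
apply/eqP; have /implyP := forallP (colg e) f; rewrite gef eqxx andbT.
move=> disj; apply: contraT => nef; have := disj nef.
by rewrite (negPf (intersect _ _ (valP e) (valP f) nef)).
Qed.

(** Each block through [x] has [k - 1] further points, and each of the [v - 1] other points shares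
    exactly one block with [x]. *)
Lemma bibd_degree v k (x : H) : BIBD H v k -> degree x * (k - 1) = v - 1.
Proof.
case=> _ cardH rankE pairE.
have := sum_card_incidence [set e in edges H | x \in e] [set~ x].
rewrite (eq_bigr (fun=> k - 1)); last first.
  move=> e; rewrite inE => /andP[/rankE <- xe]; rewrite setIC -setDE.
  by rewrite (cardsD1 x e) xe add1n subSS subn0.
rewrite sum_nat_const => ->; rewrite (eq_bigr (fun=> 1)); last first.
  move=> y; rewrite !inE eq_sym => xy; rewrite -(pairE x y xy).
  by apply: eq_card => e; rewrite !inE andbA.
by rewrite sum1_card cardsC1 cardH subn1.
Qed.
End Hypergraphs.

(** The [m + 1] points of [e] lie on [m] further lines each, giving [m * (m + 1)] incidences with
    the [m ^ 2 + m] other lines. Linearity allows at most one per line, so every line has one. *)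
Lemma plane_intersecting (P : hypergraph) m : 0 < m -> projective_plane P m ->
  [/\ forall x : P, degree x = m.+1, #|edges P| = m ^ 2 + m + 1 &
      {in edges P &, forall e f : {set P}, e != f -> e :&: f != set0}].
Proof.
move=> m_gt0 plane; have [lin cardP rankE _] := plane.
have deg (x : P) : degree x = m.+1.
  have := bibd_degree x plane; rewrite !addnK -mulnn -mulSnr.
  by move/eqP; rewrite eqn_pmul2r // => /eqP.
have cardE : #|edges P| = m ^ 2 + m + 1.
  have := sum_card_incidence (edges P) setT.
  rewrite (eq_bigr (fun=> m.+1)) => [|e /rankE]; last by rewrite setTI addn1.
  under [RHS]eq_bigr do rewrite -/(degree _) deg.
  rewrite !sum_nat_const cardsT cardP => /eqP.
  by rewrite eqn_pmul2r // => /eqP.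
split=> // e f eE fE nef.
have sumE : \sum_(g in edges P :\ e) #|e :&: g| = m.+1 * m.
  rewrite sum_card_incidence -addn1 -(rankE e eE) -sum_nat_const.
  apply: eq_bigr => x xe; apply/eqP; rewrite -eqSS -(deg x); apply/eqP.
  rewrite [RHS](cardsD1 e) inE eE xe add1n; congr _.+1.
  by apply: eq_card => g; rewrite !inE andbA.
have le1 : {in edges P :\ e, forall g, #|e :&: g| <= 1}.
  by move=> g /setD1P[ge gE]; apply: lin; rewrite // eq_sym.
rewrite -card_gt0 (eq_sum_leq le1) // ?inE 1?eq_sym ?nef //.
by rewrite sumE sum1_card; move: cardE; rewrite (cardsD1 e) eE; lia.
Qed.

(** * Extremal hypergraphs built from designs *)

(** By [bibd_degree] each point lies on [r] blocks, the rank of the dual. Two points share a block,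
    so all dual edges need different colors. *)
Lemma bibd_dual (B : hypergraph) r Delta : 1 < r -> 1 < Delta ->
  BIBD B (r * (Delta - 1) + 1) Delta ->
  exists H : hypergraph,
    [/\ uniform H, max_rank H = r, max_degree H = Delta
      & chromatic_index H = r * (Delta - 1) + 1].
Proof.
move=> r_gt1 Delta_gt1 bibd; have [lin cardB rankE pairE] := bibd.
have Delta1 : 0 < Delta - 1 by rewrite subn_gt0.
pose star (x : B) : {set {set B}} := [set e in edges B | x \in e].
have card_star x : #|star x| = r.
  by apply/eqP; rewrite -(eqn_pmul2r Delta1) (bibd_degree x bibd) addnK.
have starI x y : x != y -> #|star x :&: star y| = 1.
  move=> xy; rewrite -(pairE x y xy); apply: eq_card => e.
  by rewrite !inE; case: (e \in _).
have star_inj : injective star.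
  move=> x y Exy; apply/eqP; apply: contraLR r_gt1 => /starI.
  by rewrite -Exy setIid card_star => ->.
(* All subsets of [B] serve as vertices; those that are not blocks are isolated. *)
pose H := @Hypergraph {set B} (star @: setT).
have degH (b : {set B}) : @degree H b = if b \in edges B then #|b| else 0.
  rewrite /H degree_imset; last by move=> ? ? _ _; apply: star_inj.
  case: ifP => bE; first by apply: eq_card => x; rewrite !inE bE.
  by apply: eq_card0 => x; rewrite !inE bE.
have rankH : {in edges H, forall e : {set H}, #|e| = r}.
  by move=> _ /imsetP[x _ ->].
have /card_gt0P[x0 _] : 0 < #|B| by rewrite cardB addn1.
have /card_gt0P[b0] : 0 < #|star x0| by rewrite card_star ltnW.
rewrite inE => /andP[b0E _].
exists H; split.
- by move=> e f eE fE; rewrite !rankH.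
- by apply: (@max_rank_uniform H r (star x0)); first exact: imset_f.
- apply: (@max_degree_attained H _ b0); first by rewrite degH b0E rankE.
  by move=> b; rewrite degH; case: ifP => // /rankE->.
rewrite intersecting_chromatic_index.
  by rewrite card_imset // cardsT cardB.
move=> _ _ /imsetP[x _ ->] /imsetP[y _ ->] xy.
by rewrite -card_gt0 starI //; apply: contraNneq xy => ->.
Qed.

(** [t] is the number of copies of each line. The private vertices keep the copies distinct, edges
    being a set, and raise the rank by one without affecting the maximum degree. *)
Lemma plane_inflation (P : hypergraph) m t : 0 < m -> 0 < t ->
  projective_plane P m ->
  exists H : hypergraph,
    [/\ uniform H, max_rank H = m.+2, max_degree H = t * m.+1
      & chromatic_index H = t * (m ^ 2 + m + 1)].
Proof.
move=> m_gt0 t_gt0 plane; have [_ cardP rankE _] := plane.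
have [deg cardE meet] := plane_intersecting m_gt0 plane.
pose I := ({set P} * 'I_t)%type; pose V := (P + I)%type.
pose E (p : I) : {set V} := inr p |: [set inl x | x in p.1].
have inrE p q : (inr p \in E q) = (p == q).
  rewrite in_setU1 (inj_eq (@inr_inj _ _)); case: eqP => //= _.
  by apply/imsetP=> -[].
have inlE x q : (inl x \in E q) = (x \in q.1).
  by rewrite in_setU1 /= mem_imset //; apply: inl_inj.
have E_inj : injective E.
  by move=> p q Epq; apply/eqP; rewrite -inrE -Epq inrE.
pose A : {set I} := setX (edges P) setT.
have cardA : #|A| = t * (m ^ 2 + m + 1) by rewrite cardsX cardsT card_ord cardE mulnC.
pose H := @Hypergraph V (E @: A).
have degH (z : V) : @degree H z = #|[set p in A | z \in E p]|.
  by rewrite /H degree_imset // => ? ? _ _; apply: E_inj.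
have rankH : {in edges H, forall e : {set H}, #|e| = m.+2}.
  move=> e /imsetP[[L i] /setXP[LE _] ->].
  rewrite cardsU1 card_imset; last exact: inl_inj.
  by rewrite rankE // addn1; case: imsetP => [[]//|_]; rewrite add1n.
have degl x : @degree H (inl x) = t * m.+1.
  rewrite degH mulnC -(deg x) -[t in RHS]card_ord -cardsT -cardsX.
  by apply: eq_card => -[L i]; rewrite [LHS]inE inlE !inE /= !andbT.
have /card_gt0P[x0 _] : 0 < #|P| by rewrite cardP addn1.
have /card_gt0P[L0] : 0 < #|edges P| by rewrite cardE addn1.
move=> L0E; pose p0 : I := (L0, Ordinal t_gt0).
have p0A : p0 \in A by rewrite !inE L0E.
exists H; split.
- by move=> e f eE fE; rewrite !rankH.
- by apply: (@max_rank_uniform H _ (E p0)); first exact: imset_f.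
- apply: (@max_degree_attained H _ (inl x0)) => // -[x|p]; first by rewrite degl.
  apply: (@leq_trans 1); last by rewrite muln_gt0 t_gt0.
  rewrite degH -(cards1 p); apply/subset_leq_card/subsetP=> q.
  by rewrite inE inrE in_set1 eq_sym => /andP[].
rewrite intersecting_chromatic_index.
  by rewrite card_imset.
move=> _ _ /imsetP[[L i] LA ->] /imsetP[[M j] MA ->] _.
move: LA MA; rewrite !inE !andbT => LE ME.
have /set0Pn[x /setIP[xL xM]] : L :&: M != set0.
  have [<-|] := eqVneq L M; last exact: meet.
  by rewrite setIid -card_gt0 rankE // addn1.
by apply/set0Pn; exists (inl x); rewrite inE !inlE /= xL.
Qed.

(** The edges intersect pairwise, and counting incidences gives
    [#|edges D| * r = r * (r - 1) * Delta]. *)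
Lemma design_chromatic_index (D : hypergraph) r Delta : 1 < r -> 0 < Delta ->
  projective_design D -> #|D| = r * (r - 1) ->
  (forall e : {set D}, e \in edges D -> #|e| = r) ->
  (forall x : D, degree x = Delta) ->
  [/\ uniform D, max_rank D = r, max_degree D = Delta
    & chromatic_index D = Delta * (r - 1)].
Proof.
move=> r_gt1 Delta_gt0 [unif _ meet] cardD rankE degE.
have r_gt0 : 0 < r by apply: ltnW.
have /card_gt0P[x0 _] : 0 < #|D| by rewrite cardD muln_gt0 r_gt0 subn_gt0.
have /card_gt0P[e0] : 0 < #|[set e in edges D | x0 \in e]| by rewrite -/(degree x0) degE.
rewrite inE => /andP[e0E _].
split=> //; first exact: max_rank_uniform e0E rankE.
  by apply: (max_degree_attained (degE x0)) => x; rewrite degE.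
rewrite intersecting_chromatic_index //.
have := sum_card_incidence (edges D) setT.
rewrite (eq_bigr (fun=> r)) => [|e /rankE]; last by rewrite setTI.
under [RHS]eq_bigr do rewrite -/(degree _) degE.
rewrite !sum_nat_const cardsT cardD -mulnA mulnC => /eqP.
by rewrite eqn_pmul2l // mulnC => /eqP.
Qed.

(** * Line graphs and their largest cliques *)

Section LineGraph.
Variables (H : hypergraph) (r Delta : nat).
Hypothesis rank_le : {in edges H, forall e : {set H}, #|e| <= r}.
Hypothesis degree_le : forall x : H, degree x <= Delta.

(** The line graph of [H], extended to all vertex subsets; the non-edges are isolated. *)
Definition line_adj : rel {set H} := fun e f =>
  [&& e \in edges H, f \in edges H, e != f & e :&: f != set0].

Lemma line_adj_sym : symmetric line_adj.
Proof.
by move=> e f; rewrite /line_adj eq_sym setIC; case: (e \in _); case: (f \in _).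
Qed.

Lemma line_adj_irr : irreflexive line_adj.
Proof. by move=> e; rewrite /line_adj eqxx !andbF. Qed.

Lemma star_card_le (M : {set {set H}}) e x :
  M \subset edges H -> e \in edges H -> e \notin M -> x \in e ->
  #|[set g in M | x \in g]| <= Delta - 1.
Proof.
move=> ME eE eM xe; have := degree_le x.
rewrite /degree (cardsD1 e) inE eE xe add1n => /(leq_sub2r 1).
rewrite subSS subn0; apply: leq_trans; apply/subset_leq_card/subsetP=> g.
rewrite !inE => /andP[gM ->]; rewrite (subsetP ME) // !andbT.
by apply: contraNneq eM => <-.
Qed.

Lemma sum_card_meet_le (M : {set {set H}}) e :
  M \subset edges H -> e \in edges H -> e \notin M ->
  \sum_(g in M) #|e :&: g| <= #|e| * (Delta - 1).
Proof.
move=> ME eE eM; rewrite sum_card_incidence -sum_nat_const.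
by apply: leq_sum => x xe; apply: star_card_le eM xe.
Qed.

Lemma line_degree_le e : #|[set f | line_adj e f]| <= r * (Delta - 1).
Proof.
have [eE|eE] := boolP (e \in edges H); last first.
  rewrite (_ : [set f | _] = set0) ?cards0 //.
  by apply/setP=> f; rewrite !inE /line_adj (negPf eE).
apply: (@leq_trans (#|e| * (Delta - 1))); last by rewrite leq_mul2r rank_le ?orbT.
apply: leq_trans (sum_card_meet_le _ eE _).
- rewrite -sum1_card; apply: leq_sum => f; rewrite inE => /and4P[_ _ _].
  by rewrite card_gt0.
- by apply/subsetP=> f; rewrite inE => /and4P[].
- by rewrite inE line_adj_irr.
Qed.

Section Clique.
Variable K : {set {set H}}.
Hypothesis Delta_gt1 : 1 < Delta.
Hypothesis KE : K \subset edges H.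
Hypothesis K_meet : {in K &, forall e f, e != f -> e :&: f != set0}.
Hypothesis cardK : #|K| = r * (Delta - 1) + 1.

(** The sum of [#|e :&: g|] over the other members [g] is at least their number [r * (Delta - 1)]
    and at most [#|e| * (Delta - 1)]. Hence the bounds per member and per vertex of [e] are all
    equalities. *)
Lemma clique_tight e : e \in K ->
  {in K, forall f, e != f -> #|e :&: f| = 1} /\
  {in e, forall x, #|[set g in K | x \in g]| = Delta}.
Proof.
move=> eK; have eE := subsetP KE e eK.
have eKe : e \notin K :\ e by rewrite !inE eqxx.
have KeE : K :\ e \subset edges H by apply: subset_trans (subD1set _ _) KE.
have cardKe : #|K :\ e| = r * (Delta - 1).
  by apply: succn_inj; rewrite -[RHS]addn1 -cardK (cardsD1 e K) eK.
have le1 : {in K :\ e, forall f, 1 <= #|e :&: f|}.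
  by move=> f /setD1P[fe fK]; rewrite card_gt0 K_meet // eq_sym.
have le_r : #|e| * (Delta - 1) <= r * (Delta - 1) by rewrite leq_mul2r rank_le ?orbT.
have leS := leq_trans (sum_card_meet_le KeE eE eKe) le_r.
split=> [f fK ef|x xe].
  rewrite -(eq_sum_leq le1) //; last by rewrite !inE eq_sym ef.
  by rewrite sum1_card cardKe.
rewrite (cardsD1 e) inE eK xe add1n.
have := @eq_sum_leq _ e (fun x => #|[set g in K :\ e | x \in g]|) (fun=> Delta - 1).
move=> /(_ (fun x => star_card_le KeE eE eKe)).
rewrite -sum_card_incidence sum_nat_const => /(_ _ x xe) Ex.
rewrite (_ : _ :\ e = [set g in K :\ e | x \in g]); last first.
  by apply/setP=> g; rewrite !inE andbA.
rewrite Ex ?subn1 ?prednK ?(ltnW Delta_gt1) // -subn1.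
by apply: leq_trans le_r _; rewrite -cardKe -sum1_card leq_sum.
Qed.

(** By [clique_tight], blocks of the dual have size [Delta], and the only common vertex of two
    members of [K] yields the only block through two points. *)
Lemma clique_bibd : exists B : hypergraph, BIBD B (r * (Delta - 1) + 1) Delta.
Proof.
pose T := {e : {set H} | e \in K} : finType.
pose blk (x : H) : {set T} := [set e : T | x \in val e].
pose B := @Hypergraph T [set blk x | x in cover K].
have uniqI (e f : T) x y : e != f ->
    x \in val e -> x \in val f -> y \in val e -> y \in val f -> x = y.
  move=> ef xe xf ye yf.
  have [/(_ _ (valP f) ef) c1 _] := clique_tight (valP e).
  have /cards1P[z Ez] : #|val e :&: val f| == 1 by rewrite c1.
  have /set1P-> : x \in [set z] by rewrite -Ez inE xe.
  by apply/esym/set1P; rewrite -Ez inE ye.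
exists B; split.
- move=> _ _ /imsetP[x _ ->] /imsetP[y _ ->]; apply: contraNT.
  rewrite -ltnNge => /card_gt1P[e [f [/setIP[]]]].
  rewrite !inE => xe ye /andP[xf yf] ef.
  by rewrite (uniqI _ _ _ _ ef xe xf ye yf).
- by rewrite card_sig -cardK; apply: eq_card.
- move=> _ /imsetP[x /bigcupP[e eK xe] ->].
  have [_ /(_ x xe) <-] := clique_tight eK.
  rewrite -(card_imset _ val_inj); apply: eq_card => g.
  apply/imsetP/idP=> [[h]|]; first by rewrite !inE => xh ->; rewrite xh (valP h).
  by rewrite inE => /andP[gK xg]; exists (Sub g gK); rewrite ?inE.
move=> e f ef; apply/eqP/cards1P.
have /set0Pn[x /setIP[xe xf]] := K_meet (valP e) (valP f) ef.
exists (blk x); apply/setP=> b; rewrite !inE; apply/andP/eqP=> [[]|->].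
  case/imsetP=> y _ ->; rewrite !inE => /andP[ye yf].
  by rewrite (uniqI _ _ _ _ ef xe xf ye yf).
by rewrite !inE xe xf imset_f //; apply/bigcupP; exists (val e); first exact: valP.
Qed.
End Clique.

Lemma chromatic_index_bibd : 1 < Delta -> 2 < r ->
  chromatic_index H = r * (Delta - 1) + 1 ->
  exists B : hypergraph, BIBD B (r * (Delta - 1) + 1) Delta.
Proof.
move=> Delta_gt1 r_gt2 qH; set k := r * (Delta - 1).
(* Brooks' theorem needs three colors; [Delta - 1] may be 1, so [2 < r] enters here. *)
have k_gt2 : 2 < k by rewrite /k; nia.
pose clique (K : {set {set H}}) := (#|K| == k.+1) &&
  [forall e in K, forall f in K, (e != f) ==> line_adj e f].
have [/existsP[K /andP[/eqP cardK /forall_inP adjK]]|noK] := boolP [exists K, clique K].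
  have {}adjK e f : e \in K -> f \in K -> e != f -> line_adj e f.
    by move=> eK fK ef; have /forall_inP/(_ f fK)/implyP/(_ ef) := adjK e eK.
  apply: (@clique_bibd K) => //; last by rewrite cardK addn1.
    apply/subsetP=> e eK; have /card_gt0P[f] : 0 < #|K :\ e|.
      by move: cardK; rewrite (cardsD1 e) eK; lia.
    case/setD1P=> fe fK; rewrite eq_sym in fe.
    by have /and4P[] := adjK e f eK fK fe.
  by move=> e f eK fK ef; have /and4P[] := adjK e f eK fK ef.
have [K cardK|c cP] := brooks line_adj_sym line_adj_irr line_degree_le k_gt2.
  have := noK; rewrite negb_exists => /forallP/(_ K).
  rewrite /clique cardK eqxx /= negb_forall_in => /exists_inP[e eK].
  rewrite negb_forall_in => /exists_inP[f fK].
  by rewrite negb_imply => /andP[ef nadj]; exists e, f.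
(* Restricted to edges, the coloring of the line graph uses [k] colors, against a chromatic index of
   [k + 1]. *)
have := @chromatic_index_le H _ [ffun e : edge H => c (val e)].
rewrite qH card_ord -/k addn1 ltnn => /(_ _)/negP[]//.
apply/forallP=> e; apply/forallP=> f; apply/implyP; rewrite !ffunE.
case/andP=> ef /eqP cef; apply: contraT => meet.
have := cP (val e) (val f); rewrite /line_adj !(valP e) !(valP f) meet cef eqxx.
by rewrite (inj_eq val_inj) ef => /(_ isT).
Qed.
End LineGraph.

Theorem theorem13 (r Delta : nat) (hr : 3 <= r) (hDelta : 2 <= Delta) :
  [/\ (exists H : hypergraph,
         [/\ uniform H, max_rank H = r, max_degree H = Delta
           & chromatic_index H = r * (Delta - 1) + 1])
      <-> (exists B : hypergraph, BIBD B (r * (Delta - 1) + 1) Delta),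
      (exists P : hypergraph, projective_plane P (r - 2)) ->
      r - 1 %| Delta ->
      exists H : hypergraph,
        [/\ uniform H, max_rank H = r, max_degree H = Delta
          & chromatic_index H = (Delta * (r ^ 2 - 3 * r + 3)) %/ (r - 1)]
    & (exists D : hypergraph,
         [/\ projective_design D, #|D| = r * (r - 1),
             (forall e : {set D}, e \in edges D -> #|e| = r)
           & (forall x : D, degree x = Delta)]) ->
      exists H : hypergraph,
        [/\ uniform H, max_rank H = r, max_degree H = Delta
          & chromatic_index H = Delta * (r - 1)]].
Proof.
split; first split.
- case=> H [_ rankH degH qH]; apply: (@chromatic_index_bibd H) => //.
    by move=> e eE; rewrite -rankH; apply: (bigmax_sup e).
  by move=> x; rewrite -degH; apply: (bigmax_sup x).
- by case=> B; apply: bibd_dual => //; apply: ltnW.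
- case=> P plane /dvdnP[t Dt].
  have [m Em] : exists m, r = m.+3 by exists (r - 3); lia.
  have t_gt0 : 0 < t by case: t Dt hDelta => [->|].
  rewrite Em subSS subSS subn0 in plane.
  have [H [unif rankH degH qH]] := plane_inflation (ltn0Sn m) t_gt0 plane.
  have r1 : r - 1 = m.+2 by rewrite Em subn1.
  exists H; split; rewrite // ?qH ?degH ?Em ?Dt ?r1 // subn1.
  (* The factor [r - 1] of [Delta] cancels exactly, and [r ^ 2 - 3 * r + 3 = (m + 1) ^ 2 + (m + 1) +
     1] for [r = m + 3]. *)
  rewrite mulnAC mulnK //; congr (_ * _); nia.
case=> D [design cardD rankD degD]; exists D.
by apply: design_chromatic_index => //; apply: ltnW.
Qed.
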